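(* Consider the random graph mixture model with $\kappa$-state edge variables and $Q\ge 2$ groups. If $\kappa\ge\binom{Q+1}2$ and the $\kappa$-entry vectors $\{\mathbf p_{ql}\}_{1\le q\le l\le Q}$ are linearly independent, then the parameters $\boldsymbol\pi$ and $\{\mathbf p_{ql}\}_{1\le q\le l\le Q}$ are identifiable, up to label swapping, from the joint distribution of $K_9$.
   Context: Random graph mixture model: nodes have i.i.d. latent groups $Z_i\in\{1,\dots,Q\}$ with $\pi_q=\mathbb P(Z_i=q)\in(0,1)$, $\sum_q\pi_q=1$; edge variables $X_{ij}$ ($i<j$) are conditionally independent given all $Z$'s, with law of $X_{ij}$ depending only on $(Z_i,Z_j)$. In the $\kappa$-state model, $X_{ij}\in\{1,\dots,\kappa\}$ and $\mathbf p_{ql}=(p_{ql}(1),\dots,p_{ql}(\kappa))$ with $p_{ql}(k)=\mathbb P(X_{ij}=k\mid Z_i=q,Z_j=l)$, $\sum_kp_{ql}(k)=1$, and $\mathbf p_{ql}=\mathbf p_{lq}$. $K_n$ denotes the collection of the $\binom n2$ edge variables among $n$ nodes. ''Up to label swapping'' means up to a permutation of $\{1,\dots,Q\}$ applied simultaneously to all group-indexed parameters. *)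

(* Defs.v *)
From HB Require Import structures.
From mathcomp Require Import all_boot all_order all_algebra all_fingroup.
Set Implicit Arguments. Unset Strict Implicit. Unset Printing Implicit Defensive.
Import Order.TTheory GRing.Theory Num.Theory.
Local Open Scope ring_scope.

(* Parameters of the kappa-state random graph mixture model with Q groups:
   pi q = P(Z_i = q), p q l k = P(X_ij = k | Z_i = q, Z_j = l). *)
Definition model_params (R : realFieldType) (Q kappa : nat)
    (pi : 'I_Q -> R) (p : 'I_Q -> 'I_Q -> 'I_kappa -> R) : Prop :=
  [/\ (forall q, 0 < pi q /\ pi q < 1),
      \sum_(q < Q) pi q = 1,
      (forall q l k, 0 <= p q l k),
      (forall q l, \sum_(k < kappa) p q l k = 1)
    & (forall q l, p q l = p l q)].

Definition lin_indep_pql (R : realFieldType) (Q kappa : nat)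
    (p : 'I_Q -> 'I_Q -> 'I_kappa -> R) : Prop :=
  forall c : 'I_Q -> 'I_Q -> R,
    (forall k : 'I_kappa,
        \sum_(q < Q) \sum_(l < Q | (q <= l)%N) c q l * p q l k = 0) ->
    forall q l : 'I_Q, (q <= l)%N -> c q l = 0.

(* Joint distribution of K_n: probability that X_ij = x i j for all i < j
   (entries x i j with i >= j are ignored). *)
Definition joint_dist (R : realFieldType) (Q kappa n : nat)
    (pi : 'I_Q -> R) (p : 'I_Q -> 'I_Q -> 'I_kappa -> R)
    (x : 'I_n -> 'I_n -> 'I_kappa) : R :=
  \sum_(z : {ffun 'I_n -> 'I_Q})
     ((\prod_(i < n) pi (z i)) *
      \prod_(i < n) \prod_(j < n | (i < j)%N) p (z i) (z j) (x i j)).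

(* Main.v *)
(* Only the law of the five edges 01, 02, 03, 14 (a tree inside K_9) is used. Integrating
   test functions h1..h4 against it gives the tree moment
     sum_{q,l} pi_q pi_l <p_ql, h1> <v_q, h2> <v_q, h3> <v_l, h4>,
   where v_q = sum_r pi_r p_qr is the law of an edge seen from a node of group q.
   Linear independence of the p_ql (q <= l) makes the v_q linearly independent.
   With h4 = 1 one gets the third-order moment sum_q pi_q <v_q,h1> <v_q,h2> <v_q,h3> of a
   mixture with linearly independent components; testing it against dual vectors shows that
   every v'_t has a single nonzero coordinate on the v_a, which yields pi and the v_q up to a
   permutation. Testing the tree moment with dual vectors at the two ends of the edge 01 then
   isolates pi_a pi_b p_ab. *)

Require Import Defs.
From Stdlib Require Import FunctionalExtensionality.
From HB Require Import structures.
From mathcomp Require Import all_boot all_order all_algebra all_fingroup.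
Set Implicit Arguments. Unset Strict Implicit. Unset Printing Implicit Defensive.
Import Order.TTheory GRing.Theory Num.Theory.
Local Open Scope ring_scope.

HB.lock Definition dotv (R : pzRingType) (K : nat) (f h : 'I_K -> R) : R := \sum_k f k * h k.

Lemma dotv1 (R : pzRingType) K (f : 'I_K -> R) : dotv f (fun _ => 1) = \sum_k f k.
Proof. by rewrite dotv.unlock; apply: eq_bigr => k _; rewrite mulr1. Qed.

Lemma sumr_delta (R : pzSemiRingType) (I : finType) (F : I -> R) a :
  \sum_i F i * (i == a)%:R = F a.
Proof.
by rewrite (big_only1 a) // ?eqxx ?mulr1 // => i /negbTE-> _; rewrite mulr0.
Qed.

Lemma dotv_delta (R : pzRingType) K (f : 'I_K -> R) k :
  dotv f (fun j => (j == k)%:R) = f k.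
Proof. by rewrite dotv.unlock sumr_delta. Qed.

Lemma sum_ffun_fix (R : pzSemiRingType) (I J : finType) (i : I) (X : {ffun I -> J} -> R) :
  \sum_z X z = \sum_(a : J) \sum_(z : {ffun I -> J}) (z i == a)%:R * X z.
Proof.
rewrite exchange_big /=; apply: eq_bigr => z _; rewrite -mulr_suml (big_only1 (z i)) //.
  by rewrite eqxx mul1r.
by move=> a /negbTE ai _; rewrite eq_sym ai.
Qed.

Lemma prod_uniq_support (R : comPzRingType) (T : finType) (s : seq T) (F : T -> R) :
  uniq s -> (forall t, t \notin s -> F t = 1) -> \prod_t F t = \prod_(t <- s) F t.
Proof.
move=> s_uniq F1; rewrite (big_uniq _ s_uniq) [LHS](bigID (mem s)) /=.
by rewrite [X in _ * X]big1 ?mulr1 // => t /F1.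
Qed.

Lemma sum_upper_triangle (V : nmodType) Q (F : 'I_Q -> 'I_Q -> V) :
  \sum_q \sum_l F q l =
  \sum_(q : 'I_Q) \sum_(l : 'I_Q | (q <= l)%N) (F q l + (if (q < l)%N then F l q else 0)).
Proof.
have lower : \sum_(q : 'I_Q) \sum_(l : 'I_Q | (l < q)%N) F q l
             = \sum_(q : 'I_Q) \sum_(l : 'I_Q | (q < l)%N) F l q.
  by rewrite (exchange_big_dep xpredT).
under eq_bigr => q _ do rewrite (bigID (fun l : 'I_Q => (q <= l)%N)) /=.
rewrite big_split /=.
under [X in _ + X]eq_bigr => q _ do under eq_bigl => l do rewrite -ltnNge.
rewrite lower -big_split /=; apply: eq_bigr => q _.
rewrite big_split /=; congr (_ + _).
rewrite [RHS]big_mkcond [LHS]big_mkcond; apply: eq_bigr => l _.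
by case: (ltnP q l) => [/ltnW -> | _] //; case: ifP.
Qed.

Definition lin_indep (R : pzRingType) (Q K : nat) (w : 'I_Q -> 'I_K -> R) : Prop :=
  forall c : 'I_Q -> R, (forall k, \sum_q c q * w q k = 0) -> forall q, c q = 0.

Lemma lin_indep_dual (R : fieldType) Q K (w : 'I_Q -> 'I_K -> R) :
  lin_indep w -> exists u : 'I_Q -> 'I_K -> R, forall q r, dotv (w q) (u r) = (q == r)%:R.
Proof.
move=> w_indep; pose A := \matrix_(q, k) w q k.
have : row_free A.
  rewrite -kermx_eq0; apply/eqP/row_matrixP => i; rewrite row0.
  pose c := row i (kermx A).
  have cA0 : c *m A = 0 by rewrite -row_mul mulmx_ker row0.
  apply/rowP => q; have := w_indep (c 0) _ q; rewrite !mxE; apply => k.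
  transitivity ((c *m A) 0 k); last by rewrite cA0 mxE.
  rewrite [RHS]mxE; apply: eq_bigr => r _; by rewrite [A _ _]mxE.
case/row_freeP => B AB1; exists (fun r k => B k r) => q r.
move/matrixP: AB1 => /(_ q r); rewrite !mxE => <-.
by rewrite dotv.unlock; apply: eq_bigr => k _; rewrite mxE.
Qed.

Definition moment3 (R : pzRingType) (Q K : nat) (pi : 'I_Q -> R)
    (v : 'I_Q -> 'I_K -> R) (h1 h2 h3 : 'I_K -> R) : R :=
  \sum_q pi q * (dotv (v q) h1 * dotv (v q) h2 * dotv (v q) h3).

Section Moment3Identifiability.

Variables (R : fieldType) (Q K : nat) (pi pi' : 'I_Q -> R) (v v' u u' : 'I_Q -> 'I_K -> R).
Hypothesis pi'_neq0 : forall q, pi' q != 0.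
Hypotheses (v_sum1 : forall q, \sum_k v q k = 1) (v'_sum1 : forall q, \sum_k v' q k = 1).
Hypotheses (u_dual : forall q r, dotv (v q) (u r) = (q == r)%:R)
           (u'_dual : forall q r, dotv (v' q) (u' r) = (q == r)%:R).
Hypothesis moment3_eq : forall h1 h2 h3, moment3 pi v h1 h2 h3 = moment3 pi' v' h1 h2 h3.

Lemma weighted_dotv_v' t h :
  pi' t * dotv (v' t) h = \sum_q pi q * dotv (v q) h * dotv (v q) (u' t).
Proof.
have := moment3_eq (fun _ => 1) h (u' t).
rewrite /moment3 [in X in _ = X](big_only1 t) // => [|s /negbTE st _]; last first.
  by rewrite u'_dual st !mulr0.
rewrite u'_dual eqxx dotv1 v'_sum1 !mul1r mulr1 => <-.
by apply: eq_bigr => q _; rewrite dotv1 v_sum1 mul1r mulrA.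
Qed.

Lemma v'_expansion t k : v' t k = \sum_a dotv (v' t) (u a) * v a k.
Proof.
apply: (mulfI (pi'_neq0 t)); rewrite -[v' t k]dotv_delta weighted_dotv_v' mulr_sumr.
apply: eq_bigr => a _; rewrite mulrA weighted_dotv_v' (big_only1 a) //.
  by rewrite dotv_delta u_dual eqxx mulr1 mulrAC.
by move=> q /negbTE qa _; rewrite u_dual qa mulr0 mul0r.
Qed.

Lemma v'_coord_orthogonal t a b : a != b -> dotv (v' t) (u a) * dotv (v' t) (u b) = 0.
Proof.
move=> /negbTE ab; have := moment3_eq (u' t) (u a) (u b).
rewrite /moment3 big1 => [|q _]; last first.
  by rewrite !u_dual; have [->|_] := eqVneq q a; rewrite ?ab mulr0n ?mulr0 ?mul0r ?mulr0.
rewrite (big_only1 t) // => [|s /negbTE st _]; last by rewrite u'_dual st mulr0n !mul0r mulr0.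
rewrite u'_dual eqxx mul1r => /esym/eqP; rewrite mulf_eq0 (negbTE (pi'_neq0 t)).
by move/eqP.
Qed.

Lemma v'_in_v t : exists a, v' t = v a.
Proof.
have /existsP [a ta_neq0] : [exists a, dotv (v' t) (u a) != 0].
  apply: contraT => /existsPn coord0; have := v'_sum1 t.
  rewrite big1 => [|k _]; first by move/esym/eqP; rewrite oner_eq0.
  by rewrite v'_expansion big1 // => a _; move/negPn/eqP: (coord0 a) ->; rewrite mul0r.
have v'_ta k : v' t k = dotv (v' t) (u a) * v a k.
  rewrite v'_expansion (big_only1 a) // => b ba _.
  have /eqP := v'_coord_orthogonal t ba.
  by rewrite mulf_eq0 (negbTE ta_neq0) orbF => /eqP ->; rewrite mul0r.
have ta1 : dotv (v' t) (u a) = 1.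
  by rewrite -(v'_sum1 t) (eq_bigr _ (fun k _ => v'_ta k)) -mulr_sumr v_sum1 mulr1.
by exists a; apply: functional_extensionality => k; rewrite v'_ta ta1 mul1r.
Qed.

Lemma pi'_eq t a : v' t = v a -> pi' t = pi a.
Proof.
move=> v'_ta; have := weighted_dotv_v' t (u a).
rewrite v'_ta u_dual eqxx mulr1 (big_only1 a) // => [|q /negbTE qa _]; last first.
  by rewrite u_dual qa mulr0 mul0r.
by rewrite u_dual eqxx mulr1 -v'_ta u'_dual eqxx mulr1.
Qed.

Lemma moment3_identifiable :
  exists s : {perm 'I_Q}, forall t, pi' t = pi (s t) /\ v' t = v (s t).
Proof.
have /fin_all_exists [f v'_f] := v'_in_v.
have f_inj : injective f.
  move=> t1 t2 f12; have := u'_dual t1 t2.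
  rewrite v'_f f12 -v'_f u'_dual eqxx; case: eqP => // _ /eqP.
  by rewrite mulr0n oner_eq0.
by exists (perm f_inj) => t; rewrite permE; split; [apply: pi'_eq | ].
Qed.

End Moment3Identifiability.

Definition edge_marginal (R : pzRingType) (Q K : nat) (pi : 'I_Q -> R)
    (p : 'I_Q -> 'I_Q -> 'I_K -> R) (q : 'I_Q) (k : 'I_K) : R :=
  \sum_r pi r * p q r k.

Lemma edge_marginal_sum1 (R : realFieldType) Q K (pi : 'I_Q -> R) p (q : 'I_Q) :
  model_params pi p -> \sum_(k < K) edge_marginal pi p q k = 1.
Proof.
case=> _ pi_sum1 _ p_sum1 _; rewrite exchange_big /= -pi_sum1.
by apply: eq_bigr => r _; rewrite -mulr_sumr p_sum1 mulr1.
Qed.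

Lemma dotv_edge_marginal (R : pzRingType) Q K (pi : 'I_Q -> R)
    (p : 'I_Q -> 'I_Q -> 'I_K -> R) q h :
  \sum_l pi l * dotv (p q l) h = dotv (edge_marginal pi p q) h.
Proof.
rewrite dotv.unlock /edge_marginal; under eq_bigr do rewrite mulr_sumr.
rewrite exchange_big /=; apply: eq_bigr => k _; rewrite mulr_suml.
by apply: eq_bigr => l _; rewrite mulrA.
Qed.

Lemma edge_marginal_lin_indep (R : realFieldType) Q K (pi : 'I_Q -> R)
    (p : 'I_Q -> 'I_Q -> 'I_K -> R) :
  (forall q, pi q != 0) -> (forall q l, p q l = p l q) -> lin_indep_pql p ->
  lin_indep (edge_marginal pi p).
Proof.
move=> pi_neq0 p_sym p_indep c c_rel q.
pose C q l := c q * pi l + (if (q < l)%N then c l * pi q else 0).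
suff /p_indep /(_ q q (leqnn q)) : forall k,
    \sum_(q < Q) \sum_(l < Q | (q <= l)%N) C q l * p q l k = 0.
  by rewrite /C ltnn addr0 => /eqP; rewrite mulf_eq0 (negbTE (pi_neq0 q)) orbF => /eqP.
move=> k; rewrite -[RHS](c_rel k).
under [RHS]eq_bigr do rewrite mulr_sumr.
rewrite sum_upper_triangle; apply: eq_bigr => q' _; apply: eq_bigr => l _.
rewrite /C mulrDl !mulrA; congr (_ + _).
by case: ifP; rewrite ?mul0r // p_sym.
Qed.

(* E[h1(X_01) h2(X_02) h3(X_03) h4(X_14)], with v q the law of an edge at a node of group q. *)
Definition tree_moment (R : pzRingType) (Q K : nat) (pi : 'I_Q -> R)
    (p : 'I_Q -> 'I_Q -> 'I_K -> R) (h1 h2 h3 h4 : 'I_K -> R) : R :=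
  let v := edge_marginal pi p in
  \sum_q \sum_l pi q * pi l * dotv (p q l) h1 * dotv (v q) h2 * dotv (v q) h3 * dotv (v l) h4.

Lemma tree_moment_cst1 (R : realFieldType) Q K (pi : 'I_Q -> R) p (h1 h2 h3 : 'I_K -> R) :
  model_params pi p ->
  tree_moment pi p h1 h2 h3 (fun _ => 1) = moment3 pi (edge_marginal pi p) h1 h2 h3.
Proof.
move=> pp; apply: eq_bigr => q _.
under eq_bigr do rewrite dotv1 (edge_marginal_sum1 _ pp) mulr1 -!mulrA.
rewrite -mulr_sumr -(dotv_edge_marginal _ _ _ h1) -mulrA mulr_suml.
by congr (_ * _); apply: eq_bigr => l _; rewrite !mulrA.
Qed.

Lemma tree_moment_dual (R : pzRingType) Q K (pi : 'I_Q -> R) p (h g g' : 'I_K -> R) a b :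
  (forall q, dotv (edge_marginal pi p q) g = (q == a)%:R) ->
  (forall q, dotv (edge_marginal pi p q) g' = (q == b)%:R) ->
  tree_moment pi p h g g g' = pi a * pi b * dotv (p a b) h.
Proof.
move=> g_dual g'_dual; rewrite /tree_moment (bigD1 a) //= [X in _ + X]big1 ?addr0.
  rewrite (bigD1 b) //= [X in _ + X]big1 ?addr0 => [|l lb].
    by rewrite !g_dual g'_dual !eqxx !mulr1.
  by rewrite g'_dual (negbTE lb) mulr0.
by move=> q qa; apply: big1 => l _; rewrite g_dual (negbTE qa) !mulr0 mul0r.
Qed.

(* Entries of [y] on or below the diagonal are not read by [joint_dist]; weighting them by
   the indicator of [k0] makes each edge configuration [x] count exactly once. *)
Definition edge_test (R : pzRingType) (K n : nat) (k0 : 'I_K)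
    (h : 'I_n * 'I_n -> 'I_K -> R) (e : 'I_n * 'I_n) (k : 'I_K) : R :=
  if (e.1 < e.2)%N then h e k else (k == k0)%:R.

Lemma joint_dist_edge_moment (R : realFieldType) Q K n (pi : 'I_Q -> R) p (k0 : 'I_K)
    (h : 'I_n * 'I_n -> 'I_K -> R) :
  \sum_(y : {ffun 'I_n * 'I_n -> 'I_K})
     joint_dist pi p (fun i j => y (i, j)) * \prod_e edge_test k0 h e (y e)
  = \sum_(z : {ffun 'I_n -> 'I_Q})
     (\prod_i pi (z i)) * \prod_(e : 'I_n * 'I_n | (e.1 < e.2)%N) dotv (p (z e.1) (z e.2)) (h e).
Proof.
under eq_bigr => y _ do rewrite /joint_dist mulr_suml.
rewrite exchange_big /=; apply: eq_bigr => z _.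
under eq_bigr => y _ do rewrite pair_big_dep /= -mulrA.
rewrite -mulr_sumr; congr (_ * _).
transitivity (\prod_(e : 'I_n * 'I_n) \sum_k
    (if (e.1 < e.2)%N then p (z e.1) (z e.2) k else 1) * edge_test k0 h e k).
  rewrite bigA_distr_bigA; apply: eq_bigr => y _.
  by rewrite big_split /= big_mkcond; congr (_ * _); apply: eq_bigr => -[i j].
rewrite [RHS]big_mkcond; apply: eq_bigr => -[i j] _ /=; rewrite /edge_test /=.
case: ifP => _; first by rewrite dotv.unlock.
by rewrite (big_only1 k0) // ?eqxx ?mul1r // => k /negbTE-> _; rewrite mulr0.
Qed.

Section TreeEdgeMoment.

Variables (R : realFieldType) (Q K n : nat) (pi : 'I_Q -> R) (p : 'I_Q -> 'I_Q -> 'I_K -> R).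
Variables h1 h2 h3 h4 : 'I_K -> R.
Hypothesis pp : model_params pi p.

(* Writing 5 + n rather than n + 5 lets [i < 5 + n] compute to true for the literals below. *)
Local Notation node i := (@Ordinal (5 + n) i isT).

Definition tree_test (e : 'I_(5 + n) * 'I_(5 + n)) : 'I_K -> R :=
  if e == (node 0, node 1) then h1 else if e == (node 0, node 2) then h2 else
  if e == (node 0, node 3) then h3 else if e == (node 1, node 4) then h4 else fun _ => 1.

Lemma tree_edge_product (z : {ffun 'I_(5 + n) -> 'I_Q}) :
  \prod_(e : 'I_(5 + n) * 'I_(5 + n) | (e.1 < e.2)%N) dotv (p (z e.1) (z e.2)) (tree_test e)
  = dotv (p (z (node 0)) (z (node 1))) h1 * dotv (p (z (node 0)) (z (node 2))) h2
    * dotv (p (z (node 0)) (z (node 3))) h3 * dotv (p (z (node 1)) (z (node 4))) h4.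
Proof.
rewrite big_mkcond (prod_uniq_support
  (s := [:: (node 0, node 1); (node 0, node 2); (node 0, node 3); (node 1, node 4)])) //.
  by rewrite !big_cons big_nil mulr1 /tree_test /= !mulrA.
move=> e; rewrite /tree_test !inE !negb_or => /and4P[/negbTE-> /negbTE-> /negbTE-> /negbTE->].
by case: ifP => // _; rewrite dotv1; case: pp => _ _ _ ->.
Qed.

(* Once z 0 = a and z 1 = b are fixed, the summand of [tree_node_sum] factors over nodes. *)
Definition node_weight (a b : 'I_Q) (i : 'I_(5 + n)) (r : 'I_Q) : R :=
  if i == node 0 then (r == a)%:R else if i == node 1 then dotv (p a r) h1 * (r == b)%:R
  else if i == node 2 then dotv (p a r) h2 else if i == node 3 then dotv (p a r) h3
  else if i == node 4 then dotv (p b r) h4 else 1.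

Lemma node_weight_prod a b (z : {ffun 'I_(5 + n) -> 'I_Q}) :
  (z (node 1) == b)%:R * ((z (node 0) == a)%:R * ((\prod_i pi (z i)) *
    (dotv (p (z (node 0)) (z (node 1))) h1 * dotv (p (z (node 0)) (z (node 2))) h2
     * dotv (p (z (node 0)) (z (node 3))) h3 * dotv (p (z (node 1)) (z (node 4))) h4)))
  = \prod_i (pi (z i) * node_weight a b i (z i)).
Proof.
rewrite big_split /= (prod_uniq_support
  (s := [:: node 0; node 1; node 2; node 3; node 4]) (F := fun i => node_weight a b i (z i))) //.
  rewrite !big_cons big_nil /node_weight /=.
  have [<-|_] := eqVneq (z (node 0)) a; last by rewrite mulr0n !(mul0r, mulr0).
  have [<-|_] := eqVneq (z (node 1)) b; last by rewrite mulr0n !(mul0r, mulr0).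
  by rewrite mulr1n !mul1r !mulr1 !mulrA.
move=> i; rewrite /node_weight !inE !negb_or.
by case/and5P => /negbTE-> /negbTE-> /negbTE-> /negbTE-> /negbTE->.
Qed.

Lemma tree_node_sum :
  \sum_(z : {ffun 'I_(5 + n) -> 'I_Q}) (\prod_i pi (z i)) *
    (dotv (p (z (node 0)) (z (node 1))) h1 * dotv (p (z (node 0)) (z (node 2))) h2
     * dotv (p (z (node 0)) (z (node 3))) h3 * dotv (p (z (node 1)) (z (node 4))) h4)
  = tree_moment pi p h1 h2 h3 h4.
Proof.
rewrite (sum_ffun_fix (node 0)) /tree_moment; apply: eq_bigr => a _.
rewrite (sum_ffun_fix (node 1)); apply: eq_bigr => b _.
under eq_bigr do rewrite node_weight_prod.
rewrite -(bigA_distr_bigA (fun i r => pi r * node_weight a b i r)) /=.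
rewrite (prod_uniq_support (s := [:: node 0; node 1; node 2; node 3; node 4])) //.
  rewrite !big_cons big_nil /node_weight /= mulr1 sumr_delta.
  under eq_bigr do rewrite mulrA; rewrite sumr_delta !dotv_edge_marginal.
  by rewrite !mulrA.
move=> i; rewrite /node_weight !inE !negb_or.
case/and5P => /negbTE-> /negbTE-> /negbTE-> /negbTE-> /negbTE->.
by under eq_bigr do rewrite mulr1; case: pp.
Qed.

End TreeEdgeMoment.

Lemma model_params_pi_neq0 (R : realFieldType) Q K (pi : 'I_Q -> R)
    (p : 'I_Q -> 'I_Q -> 'I_K -> R) q :
  model_params pi p -> pi q != 0.
Proof. by case=> pi_pos _ _ _ _; rewrite lt0r_neq0 // (proj1 (pi_pos q)). Qed.

Lemma model_params_K_gt0 (R : realFieldType) Q K (pi : 'I_Q -> R)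
    (p : 'I_Q -> 'I_Q -> 'I_K -> R) :
  model_params pi p -> (0 < K)%N.
Proof.
case: K p => // p [_ pi_sum1 _ p_sum1 _].
case: Q pi p pi_sum1 p_sum1 => [|Q] pi p.
  by rewrite big_ord0 => /eqP; rewrite eq_sym oner_eq0.
by move=> _ /(_ ord0 ord0); rewrite big_ord0 => /eqP; rewrite eq_sym oner_eq0.
Qed.

Lemma tree_moment_joint_dist (R : realFieldType) Q K n (pi : 'I_Q -> R) p (k0 : 'I_K)
    (h1 h2 h3 h4 : 'I_K -> R) :
  model_params pi p ->
  \sum_(y : {ffun 'I_(5 + n) * 'I_(5 + n) -> 'I_K}) joint_dist pi p (fun i j => y (i, j))
     * \prod_e edge_test k0 (tree_test h1 h2 h3 h4) e (y e)
  = tree_moment pi p h1 h2 h3 h4.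
Proof.
move=> pp; rewrite joint_dist_edge_moment.
under eq_bigr do rewrite (tree_edge_product _ _ _ _ pp).
exact: tree_node_sum.
Qed.

Lemma tree_moment_determined (R : realFieldType) Q K n (pi pi' : 'I_Q -> R) p p' :
  model_params pi p -> model_params pi' p' ->
  (forall x : 'I_(5 + n) -> 'I_(5 + n) -> 'I_K, joint_dist pi p x = joint_dist pi' p' x) ->
  forall h1 h2 h3 h4, tree_moment pi p h1 h2 h3 h4 = tree_moment pi' p' h1 h2 h3 h4.
Proof.
move=> pp pp' joint_eq h1 h2 h3 h4; pose k0 := Ordinal (model_params_K_gt0 pp).
rewrite -(tree_moment_joint_dist n k0 h1 h2 h3 h4 pp).
rewrite -(tree_moment_joint_dist n k0 h1 h2 h3 h4 pp').
by apply: eq_bigr => y _; rewrite joint_eq.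
Qed.

Lemma tree_moment_identifiable (R : realFieldType) Q K (pi pi' : 'I_Q -> R)
    (p p' : 'I_Q -> 'I_Q -> 'I_K -> R) :
  model_params pi p -> model_params pi' p' -> lin_indep_pql p -> lin_indep_pql p' ->
  (forall h1 h2 h3 h4, tree_moment pi p h1 h2 h3 h4 = tree_moment pi' p' h1 h2 h3 h4) ->
  exists s : {perm 'I_Q}, (forall q, pi' q = pi (s q)) /\ (forall q l, p' q l = p (s q) (s l)).
Proof.
move=> pp pp' p_indep p'_indep tree_eq.
have v_indep pi0 (p0 : 'I_Q -> 'I_Q -> 'I_K -> R) :
    model_params pi0 p0 -> lin_indep_pql p0 -> lin_indep (edge_marginal pi0 p0).
  move=> pp0; apply: edge_marginal_lin_indep; last by case: pp0.
  by move=> q; apply: model_params_pi_neq0 pp0.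
have [u u_dual] := lin_indep_dual (v_indep _ _ pp p_indep).
have [u' u'_dual] := lin_indep_dual (v_indep _ _ pp' p'_indep).
have moment3_eq h1 h2 h3 :
    moment3 pi (edge_marginal pi p) h1 h2 h3 = moment3 pi' (edge_marginal pi' p') h1 h2 h3.
  by rewrite -!tree_moment_cst1.
have [s pv_s] := moment3_identifiable (fun q => model_params_pi_neq0 q pp')
  (fun q => edge_marginal_sum1 q pp) (fun q => edge_marginal_sum1 q pp')
  u_dual u'_dual moment3_eq.
exists s; split => [q | a b]; first by case: (pv_s q).
have v_dual_s q c : dotv (edge_marginal pi p q) (u' c) = (q == s c)%:R.
  by rewrite -(permKV s q) -(pv_s _).2 u'_dual (inj_eq perm_inj).
apply: functional_extensionality => k.
have := tree_eq (fun j => (j == k)%:R) (u' a) (u' a) (u' b).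
rewrite (tree_moment_dual _ (v_dual_s ^~ a) (v_dual_s ^~ b)).
rewrite (tree_moment_dual _ (u'_dual ^~ a) (u'_dual ^~ b)).
rewrite !dotv_delta !(proj1 (pv_s _)) => /mulfI -> //.
by rewrite mulf_neq0 // (model_params_pi_neq0 _ pp).
Qed.

Unset Implicit Arguments.
Set Strict Implicit.

Theorem theorem7 (R : realFieldType) (Q kappa : nat)
    (pi pi' : 'I_Q -> R) (p p' : 'I_Q -> 'I_Q -> 'I_kappa -> R) :
  (2 <= Q)%N ->
  ('C(Q.+1, 2) <= kappa)%N ->
  model_params pi p -> lin_indep_pql p ->
  model_params pi' p' -> lin_indep_pql p' ->
  (forall x : 'I_9 -> 'I_9 -> 'I_kappa,
      @joint_dist R Q kappa 9%N pi p x = @joint_dist R Q kappa 9%N pi' p' x) ->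
  exists s : {perm 'I_Q},
    (forall q, pi' q = pi (s q)) /\
    (forall q l, p' q l = p (s q) (s l)).
Proof.
move=> _ _ pp p_indep pp' p'_indep joint_eq.
apply: tree_moment_identifiable => //.
exact: (tree_moment_determined (n := 4)).
Qed.
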